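(* For every integer $n>1$, the map $\Phi$ is a bijection between well-labelled Motzkin paths of size $n$ and labelled binary trees with $n$ leaves.
   Context: A well-labelled path of size $n$ is a pair $(\mathbf{p},\sigma)$ with $\mathbf{p}=p_1\ldots p_{n-1}$ a word on $\{-1,0,+1\}$ and $\sigma$ a permutation of $[n]$ such that $p_i=-1\Rightarrow\sigma_i<\sigma_{i+1}$ and $p_i=1\Rightarrow\sigma_i>\sigma_{i+1}$; it is Motzkin if $\sum_{i=1}^jp_i\ge0$ for $j=1,\ldots,n-2$ and $\sum_{i=1}^{n-1}p_i=-1$. A labelled binary tree of size $n$ is a rooted tree with $n$ leaves carrying distinct labels in $[n]$, each unlabelled internal vertex having exactly two unordered children. For a set $I$ of $m$ integers, $\lambda_I$ is the order-preserving bijection $[m]\to I$; for a bijection $\lambda$ and a tree $\tau$, $\lambda(\tau)$ replaces each leaf label $i$ by $\lambda(i)$. The map $\Phi$ is defined recursively on a Motzkin path $(\mathbf{p},\sigma)$ of size $n\ge2$: (i) if $n=2$ (so $\mathbf{p}=(-1)$, $\sigma=12$), $\Phi(\mathbf{p},\sigma)$ is the tree with a root and two leaves labelled $1,2$. (ii) If $n>2$ and $p_1=0$, let $\mathbf{p}'=p_2\ldots p_{n-1}$ and $\sigma'_i=\lambda^{-1}_{[n]\setminus\{\sigma_1\}}(\sigma_{i+1})$ for $i=1,\ldots,n-1$; then $\Phi(\mathbf{p},\sigma)$ is the tree consisting of a root whose two subtrees are a leaf labelled $\sigma_1$ and $\lambda_{[n]\setminus\{\sigma_1\}}(\Phi(\mathbf{p}',\sigma'))$.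 (iii) If $n>2$ and $p_1=1$, let $k$ be the least integer with $\sum_{i=1}^kp_i=0$, let $I'=\{\sigma_1,\ldots,\sigma_k\}$, $I''=\{\sigma_{k+1},\ldots,\sigma_n\}$, $p'_i=-p_{k-i}$ ($1\le i\le k-1$), $p''_i=p_{k+i}$ ($1\le i\le n-k-1$), $\sigma'_i=\lambda^{-1}_{I'}(\sigma_{k+1-i})$ ($1\le i\le k$), $\sigma''_i=\lambda^{-1}_{I''}(\sigma_{k+i})$ ($1\le i\le n-k$); then $\Phi(\mathbf{p},\sigma)$ is the tree consisting of a root whose two subtrees are $\lambda_{I'}(\Phi(\mathbf{p}',\sigma'))$ and $\lambda_{I''}(\Phi(\mathbf{p}'',\sigma''))$. *)

(* Defs.v *)
From mathcomp Require Import all_boot all_order all_algebra.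
Set Implicit Arguments. Unset Strict Implicit. Unset Printing Implicit Defensive.
Import GRing.Theory Num.Theory.
Local Open Scope ring_scope.

(** * Well-labelled paths
    A path of size n is a pair (p, s) with p : seq int (the steps p_1..p_{n-1})
    and s : seq nat (the labels sigma_1..sigma_n, 1-based values). *)
Definition wlpath := (seq int * seq nat)%type.

Fixpoint psums (acc : int) (p : seq int) : seq int :=
  match p with
  | [::] => [::]
  | x :: q => (acc + x) :: psums (acc + x) q
  end.

Definition well_labelled (n : nat) (w : wlpath) : Prop :=
  let: (p, s) := w in
  [/\ size p = n.-1,
      all (fun x => x \in [:: -1; 0; 1]) p,
      perm_eq s (iota 1 n) &
      forall i : nat, (i < n.-1)%N ->
        (nth 0 p i = -1 -> (nth 0%N s i < nth 0%N s i.+1)%N) /\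
        (nth 0 p i = 1 -> (nth 0%N s i.+1 < nth 0%N s i)%N)].

Definition motzkin_wl (n : nat) (w : wlpath) : Prop :=
  well_labelled n w /\
  (forall j : nat, (1 <= j <= n - 2)%N -> 0 <= \sum_(i <- take j w.1) i) /\
  \sum_(i <- w.1) i = -1.

(** * Labelled binary trees (ordered representation; unordered trees are
    ordered trees up to [tree_iso], i.e. swapping children). *)
Inductive btree : Type :=
| Leaf of nat
| Node of btree & btree.

Fixpoint leaves (t : btree) : seq nat :=
  match t with
  | Leaf l => [:: l]
  | Node a b => leaves a ++ leaves b
  end.

Definition is_lbtree (n : nat) (t : btree) : Prop := perm_eq (leaves t) (iota 1 n).

Fixpoint tree_iso (t u : btree) : bool :=
  match t, u with
  | Leaf a, Leaf b => a == b
  | Node a1 a2, Node b1 b2 =>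
      (tree_iso a1 b1 && tree_iso a2 b2) || (tree_iso a1 b2 && tree_iso a2 b1)
  | _, _ => false
  end.

Fixpoint relabel (f : nat -> nat) (t : btree) : btree :=
  match t with
  | Leaf l => Leaf (f l)
  | Node a b => Node (relabel f a) (relabel f b)
  end.

(** lambda_I : [m] -> I order-preserving; lambda_I^{-1} its inverse *)
Definition lam (I : seq nat) (i : nat) : nat := nth 0%N (sort leq I) i.-1.
Definition laminv (I : seq nat) (x : nat) : nat := (index x (sort leq I)).+1.

Fixpoint phi_fuel (fuel : nat) (p : seq int) (s : seq nat) : btree :=
  match fuel with
  | O => Leaf 0
  | S f =>
    let n := size s in
    if (n <= 2)%N then Node (Leaf 1) (Leaf 2)
    else match p with
      | x :: p' =>
        if x == 0 then
          let s1 := head 0%N s in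
          let I := [seq i <- iota 1 n | i != s1] in
          let s' := map (laminv I) (behead s) in
          Node (Leaf s1) (relabel (lam I) (phi_fuel f p' s'))
        else if x == 1 then
          let k := (find (fun y => y == 0) (psums 0 p)).+1 in
          let I1 := take k s in
          let I2 := drop k s in
          let p1 := map (fun y => - y) (rev (take k.-1 p)) in
          let p2 := drop k p in
          let s1 := map (laminv I1) (rev (take k s)) in
          let s2 := map (laminv I2) (drop k s) in
          Node (relabel (lam I1) (phi_fuel f p1 s1))
               (relabel (lam I2) (phi_fuel f p2 s2))
        else Leaf 0
      | [::] => Leaf 0
      end
  end.

Definition Phi (w : wlpath) : btree := phi_fuel (size w.2) w.1 w.2.

(* Main.v *)
Require Import Defs.
From mathcomp Require Import all_boot all_order all_algebra.
From mathcomp Require Import zify.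
Set Implicit Arguments. Unset Strict Implicit. Unset Printing Implicit Defensive.
Import GRing.Theory Num.Theory.
Local Open Scope ring_scope.

(** The inverse [Psi] of [Phi] can be written directly on trees with arbitrary
    distinct labels. A leaf attached at the root gives an initial flat step. Two
    subtrees that are not leaves give two Motzkin paths; one of them is reversed
    and negated, and they are joined by a down step. The label condition at that
    step says that the reversed path is the one with the smaller first label, so
    the order of the two children is irrelevant. Conversely the first return to
    height 0 recovers the joining step. As [Psi] commutes with increasing
    relabellings, the standardizations in the definition of [Phi] cancel. *)

(** * Standardization of label sets *)

Lemma perm_sort_leq (I J : seq nat) : perm_eq I J -> sort leq I = sort leq J.
Proof. by move/(perm_sortP leq_total leq_trans anti_leq). Qed.

Lemma lam_perm (I J : seq nat) : perm_eq I J -> lam I = lam J.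
Proof. by move=> IJ; rewrite /lam (perm_sort_leq IJ). Qed.

Lemma laminv_perm (I J : seq nat) : perm_eq I J -> laminv I = laminv J.
Proof. by move=> IJ; rewrite /laminv (perm_sort_leq IJ). Qed.

Lemma laminvK (I : seq nat) : {in I, cancel (laminv I) (lam I)}.
Proof. by move=> x xI; rewrite /lam /laminv /= nth_index // mem_sort. Qed.

Lemma map_lam_laminv (I : seq nat) : map (lam I) (map (laminv I) I) = I.
Proof. by rewrite -map_comp -[RHS]map_id; apply/eq_in_map/laminvK. Qed.

(** Monotonicity is confined to [iota 1 (size I)]: because of the shift [.-1], [lam I] takes the
    same value at 0 and 1, and beyond [size I] it returns the default 0. *)
Lemma lam_homo (I : seq nat) : uniq I ->
  {in iota 1 (size I) &, {homo lam I : x y / (x < y)%N}}.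
Proof.
move=> uI x y; rewrite !mem_iota => hx hy xy; rewrite /lam.
apply: (sorted_ltn_nth ltn_trans); rewrite ?inE ?size_sort; try lia.
by rewrite ltn_sorted_uniq_leq sort_uniq uI sort_sorted //; exact: leq_total.
Qed.

Lemma laminv_homo (I : seq nat) : {in I &, {homo laminv I : x y / (x < y)%N}}.
Proof.
move=> x y xI yI xy; rewrite ltnNge leq_eqVlt; apply/negP => /orP[/eqP e|].
  by move: xy; rewrite -(laminvK xI) -e laminvK // ltnn.
rewrite /laminv ltnS => /(sorted_ltn_index leq_trans (sort_sorted leq_total I)).
by rewrite !mem_sort => /(_ yI xI); rewrite leqNgt xy.
Qed.

Lemma perm_map_laminv (I : seq nat) :
  uniq I -> perm_eq (map (laminv I) I) (iota 1 (size I)).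
Proof.
move=> uI; have <- : map (laminv I) (sort leq I) = iota 1 (size I).
  apply: (@eq_from_nth _ 0%N) => [|i]; rewrite size_map size_sort ?size_iota //.
  move=> hi; rewrite (nth_map 0%N) ?size_sort // nth_iota // /laminv.
  by rewrite index_uniq ?size_sort ?sort_uniq.
by apply: perm_map; rewrite perm_sym perm_sort.
Qed.

Lemma last_rev (T : Type) (x : T) s : last x (rev s) = head x s.
Proof. by case: s => //= a s; rewrite rev_cons last_rcons. Qed.

Lemma head_rev (T : Type) (x : T) s : head x (rev s) = last x s.
Proof. by rewrite -last_rev revK. Qed.

(** * Motzkin excursions *)

(** The path traversed backwards, which is how $\mathbf{p}'$ arises in clause (iii) of $\Phi$. *)
Definition flip (p : seq int) : seq int := map (fun y => - y) (rev p).

Lemma size_flip p : size (flip p) = size p.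
Proof. by rewrite size_map size_rev. Qed.

Lemma flipK : involutive flip.
Proof.
move=> p; rewrite /flip -map_rev revK -map_comp -[RHS]map_id.
by apply: eq_map => x /=; rewrite opprK.
Qed.

Lemma flip_cons x p : flip (x :: p) = rcons (flip p) (- x).
Proof. by rewrite /flip rev_cons map_rcons. Qed.

Lemma flip_rcons x p : flip (rcons p x) = - x :: flip p.
Proof. by rewrite /flip rev_rcons. Qed.

(* [u] leads from height [a] to height [b] without going below 0. *)
Fixpoint excursion (a : int) (u : seq int) (b : int) : bool :=
  (0 <= a) && (if u is x :: u' then excursion (a + x) u' b else a == b).

Lemma excursion_ge0 a u b : excursion a u b -> 0 <= a.
Proof. by case: u => [|x u] /= /andP[]. Qed.

Lemma excursion_cat a u b v c :
  excursion a u b -> excursion b v c -> excursion a (u ++ v) c.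
Proof.
elim: u a => [|x u IH] a /= /andP[a0]; first by move/eqP->.
by move=> h1 h2; rewrite a0 IH.
Qed.

Lemma excursion_shift c a u b :
  0 <= c -> excursion a u b -> excursion (a + c) u (b + c).
Proof.
move=> c0; elim: u a => [|x u IH] a /= /andP[a0].
  by move/eqP<-; rewrite addr_ge0 // eqxx.
by move=> h; rewrite addr_ge0 // addrAC IH.
Qed.

Lemma excursion_flip a u b : excursion a u b -> excursion b (flip u) a.
Proof.
elim: u a => [|x u IH] a /= /andP[a0].
  by move/eqP=> <-; rewrite a0 eqxx.
move=> h; rewrite flip_cons -cats1; apply: excursion_cat (IH _ h) _.
by rewrite /= (excursion_ge0 h) addrK a0 eqxx.
Qed.

Lemma excursionP a u b :
  reflect ((forall j, (j <= size u)%N -> 0 <= a + \sum_(i <- take j u) i) /\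
           a + \sum_(i <- u) i = b)
          (excursion a u b).
Proof.
elim: u a => [|x u IH] a /=.
  rewrite big_nil addr0; apply: (iffP andP) => -[h1 h2].
    by split; [move=> j _ | exact/eqP].
  by split; [exact: (h1 0%N) | exact/eqP].
apply: (iffP andP) => [[a0 /IH[h1 h2]]|[h1 h2]].
  split; last by rewrite big_cons addrA.
  by case=> [_|j hj]; rewrite /= ?big_nil ?addr0 // big_cons addrA h1.
split; first by have := h1 0%N isT; rewrite /= big_nil addr0.
apply/IH; split; last by move: h2; rewrite big_cons addrA.
by move=> j hj; have := h1 j.+1 hj; rewrite /= big_cons addrA.
Qed.

(** Steps are at least -1, so a path from height [h + 1] cannot jump over a height and first reaches
    0 by a step -1 from height 1. Before that step it stays at height at least 1, and [u1] is this
    part lowered by one. *)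
Lemma excursion_first_passage h u :
  0 <= h -> all (fun x => -1 <= x) u -> excursion (h + 1) u 0 ->
  exists u1 v : seq int, [/\ u = u1 ++ -1 :: v, excursion h u1 0 & excursion 0 v 0].
Proof.
elim: u h => [|x u IH] h h0 /=; first by move=> _ /andP[_ /eqP]; lia.
case/andP=> x1 hu /andP[_ hx].
case: (boolP (0 <= h + x)) => hhx.
  have [|u1 [v [-> e1 e2]]] := IH _ hhx hu; first by rewrite addrAC.
  by exists (x :: u1), v; rewrite /= h0.
have [eh ex] : h = 0 /\ x = -1 by lia.
by exists [::], u; split; rewrite ?ex ?eh //; move: hx; rewrite eh ex.
Qed.

(** Lifted by one, the excursion stays positive, so the first vanishing partial sum is the one
    produced by the step -1 right after [u]. *)
Lemma find_first_return a u q : excursion a u 0 ->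
  find (fun y => y == 0) (psums (a + 1) (u ++ -1 :: q)) = size u.
Proof.
elim: u a => [|x u IH] a /= /andP[a0]; first by move/eqP->.
move=> h; rewrite (addrAC a) ifN; first by rewrite IH.
by have := excursion_ge0 h; lia.
Qed.

(** Nonnegative heights before the last step and total -1 force that step to be -1, taken from
    height 0; the rest is an excursion. *)
Definition motzkin (p : seq int) : Prop :=
  exists2 u : seq int, p = rcons u (-1) & excursion 0 u 0.

(** * Labelled Motzkin paths with arbitrary labels *)

Definition step_ok (x : int) (a b : nat) : bool :=
  [&& x \in [:: -1; 0; 1], (x == -1) ==> (a < b)%N & (x == 1) ==> (b < a)%N].

Lemma step_okN x a b : step_ok (- x) b a = step_ok x a b.
Proof. by rewrite /step_ok !inE; apply/idP/idP; lia. Qed.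

Definition labelled (p : seq int) (s : seq nat) : Prop :=
  size s = (size p).+1 /\
  forall i, (i < size p)%N -> step_ok p`_i (nth 0%N s i) (nth 0%N s i.+1).

Lemma labelled_cat p x q s r : size s = (size p).+1 ->
  labelled (p ++ x :: q) (s ++ r) <->
  [/\ labelled p s, step_ok x (last 0%N s) (head 0%N r) & labelled q r].
Proof.
move=> es; split.
  case; rewrite !size_cat /= => er h; split.
  - split=> // i hi; have := h i; rewrite !nth_cat hi es !ifT; try lia.
    by apply; lia.
  - have := h (size p); rewrite !nth_cat es !ltnn !subnn ifT // /= -nth0.
    by rewrite -nth_last es; apply; lia.
  - split; first lia.
    (* One index serves both lists: it is position [i.+1] of [x :: q] behind [p], and position [i]
       of [r] behind the longer list [s]. *)
    move=> i hi; have := h (size p + i.+1)%N; rewrite !nth_cat es !ifF; try lia.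
    have -> : (size p + i.+1 - size p = i.+1)%N by lia.
    have -> : (size p + i.+1 - (size p).+1 = i)%N by lia.
    have -> : ((size p + i.+1).+1 - (size p).+1 = i.+1)%N by lia.
    by apply; lia.
case=> -[_ h1] h2 [er h3]; split; first by rewrite !size_cat /=; lia.
move=> i; rewrite size_cat /= !nth_cat es => hi.
case: (ltngtP i (size p)) => hip.
- by rewrite !ifT; try lia; apply: h1.
- have [j ej] : exists j, i = (size p + j.+1)%N by exists (i - size p).-1; lia.
  rewrite ej !ifF; try lia.
  have -> : (size p + j.+1 - size p = j.+1)%N by lia.
  have -> : (size p + j.+1 - (size p).+1 = j)%N by lia.
  have -> : ((size p + j.+1).+1 - (size p).+1 = j.+1)%N by lia.
  by apply: h3; lia.
- by rewrite hip ifT // ltnn !subnn nth0 /= -[X in nth _ _ X]/((size p).+1.-1) -es nth_last.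
Qed.

Lemma labelled_cons x p a s :
  labelled (x :: p) (a :: s) <-> step_ok x a (head 0%N s) /\ labelled p s.
Proof.
rewrite -[x :: p]cat0s -[a :: s]cat1s labelled_cat //; split; first by case.
by case=> h1 h2; split=> //; split.
Qed.

Lemma labelled_flip p s : labelled p s -> labelled (flip p) (rev s).
Proof.
case=> es h; split; rewrite ?size_rev size_flip // => i hi.
rewrite (nth_map 0) ?size_rev // !nth_rev ?es //; try lia.
rewrite step_okN.
have -> : ((size p).+1 - i.+1 = (size p - i.+1).+1)%N by lia.
have -> : ((size p).+1 - i.+2 = size p - i.+1)%N by lia.
by apply: h; rewrite ltn_subrL (leq_trans _ hi).
Qed.

Lemma labelled_steps p s :
  labelled p s -> all (fun x => x \in [:: -1; 0; 1]) p.
Proof. by case=> _ h; apply/(all_nthP 0) => i /h /and3P[]. Qed.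

(* The three constructors mirror the three clauses defining Phi. *)
Inductive lmotzkin : seq int -> seq nat -> Prop :=
| lmotzkin_pair a b : (a < b)%N -> lmotzkin [:: -1] [:: a; b]
| lmotzkin_flat a p s : lmotzkin p s -> lmotzkin (0 :: p) (a :: s)
| lmotzkin_join p s q r : lmotzkin p s -> lmotzkin q r ->
    (head 0%N s < head 0%N r)%N ->
    lmotzkin (flip p ++ -1 :: q) (rev s ++ r).

Lemma lmotzkin_labelled p s : lmotzkin p s -> labelled p s /\ motzkin p.
Proof.
elim=> {p s} [a b ab|a p s _ [wp [u ep hu]]|p s q r _ [wp [u ep hu]] _ [wq [v eq hv]] sr].
- by split; [split=> // -[|i] //= _; rewrite /step_ok ab | exists [::]].
- split; [exact/labelled_cons | by exists (0 :: u); rewrite ?ep].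
- split.
    apply/labelled_cat; first by rewrite size_rev size_flip; case: wp.
    split=> //; first exact: labelled_flip.
    by rewrite last_rev /step_ok /= sr.
  exists (flip p ++ -1 :: v); first by rewrite eq rcons_cat.
  rewrite ep flip_rcons opprK.
  (* The reversed path goes up once and then runs as an excursion lifted to height 1, from which the
     joining step descends to 0. *)
  apply: (@excursion_cat _ _ 1); last by rewrite /= subrr.
  exact: (@excursion_shift 1 0 _ 0) (excursion_flip hu).
Qed.

(** Strong induction on the length. A single step gives a pair; otherwise the first step is 0 or 1
    since heights are nonnegative, and after a 1 the path is cut at its first return to height 0. *)
Lemma labelled_lmotzkin p s : labelled p s -> motzkin p -> lmotzkin p s.
Proof.
elim: {p}(size p) {-2}p s (leqnn (size p)) => [|m IH] p s hm wp [u ep hu].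
  by move: hm; rewrite ep size_rcons.
case: u => [|x u] in ep hu *.
  rewrite {}ep /= in wp *; case: wp => es /(_ 0%N isT).
  by case: s es => [|a [|b [|]]] //= _ /and3P[_ ab _]; apply: lmotzkin_pair.
rewrite {}ep /= add0r in hm hu wp *.
have [a [s' es]] : exists a s', s = a :: s'.
  by case: s wp => [[]|a s'] //; exists a, s'.
rewrite {}es in wp *; have /labelled_cons[hx wp'] := wp.
have := labelled_steps wp; rewrite /= => /andP[x_in steps].
have x0 := excursion_ge0 hu.
have [ex|ex] : x = 0 \/ x = 1 by move: x_in; rewrite !inE; lia.
  rewrite ex; apply: lmotzkin_flat; apply: IH => //.
  by exists u => //; move: hu; rewrite ex.
rewrite {}ex in hu wp *.
have steps' : all (fun y => -1 <= y) u.
  move: steps; rewrite all_rcons => /andP[_]; apply: sub_all => y.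
  by rewrite !inE; lia.
have [||u1 [v [eu h1 h2]]] := @excursion_first_passage 0 u _ steps' => //.
rewrite eu rcons_cat /= in hm wp *.
(* The initial up step stays in [p']: reversal turns it into the final -1 that [motzkin] demands. *)
set p' : seq int := 1 :: u1; set q : seq int := rcons v (-1).
move: wp; rewrite -[1 :: _]/(p' ++ -1 :: q).
set k := (size p').+1; rewrite -(cat_take_drop k (a :: s')) => wp.
have ek : size (take k (a :: s')) = k.
  have [+ _] := wp; rewrite cat_take_drop => e; rewrite size_takel // e.
  by rewrite size_cat ltnS leq_addr.
have [w1 hst w2] := (labelled_cat _ _ _ ek).1 wp.
rewrite size_cat /= size_rcons in hm.
rewrite -[p']flipK -[take k _]revK; apply: lmotzkin_join.
- apply: IH; [by rewrite size_flip /p' /=; lia | exact: labelled_flip |].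
  by exists (flip u1); rewrite ?flip_cons //; apply: excursion_flip.
- by apply: IH => //; [rewrite size_rcons; lia | exists v].
(* The label condition at the joining step compares the last label of the left factor, which is the
   first one after reversal. *)
- by rewrite head_rev; case/and3P: hst.
Qed.

Lemma lmotzkinP p s : lmotzkin p s <-> labelled p s /\ motzkin p.
Proof.
by split=> [|[]]; [exact: lmotzkin_labelled | exact: labelled_lmotzkin].
Qed.

Lemma lmotzkin_size p s : lmotzkin p s -> size s = (size p).+1.
Proof. by case/lmotzkin_labelled=> -[]. Qed.

Lemma lmotzkin_size_gt1 p s : lmotzkin p s -> (1 < size s)%N.
Proof.
by case/lmotzkin_labelled=> -[-> _] [u -> _]; rewrite size_rcons.
Qed.

Lemma head_map_nat (f : nat -> nat) s :
  (0 < size s)%N -> head 0%N (map f s) = f (head 0%N s).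
Proof. by case: s. Qed.

Lemma mem_head_nat (s : seq nat) : (0 < size s)%N -> head 0%N s \in s.
Proof. by case: s => //= a s _; rewrite mem_head. Qed.

Lemma lmotzkin_map (f : nat -> nat) p s :
  {in s &, {homo f : x y / (x < y)%N}} -> lmotzkin p s -> lmotzkin p (map f s).
Proof.
move=> + w; elim: w => {p s} [a b ab|a p s w IH|p s q r wp IHp wq IHq sr] hf /=.
- by apply: lmotzkin_pair; apply: hf; rewrite ?inE ?eqxx ?orbT.
- apply: lmotzkin_flat; apply: IH => x y xs ys.
  by apply: hf; rewrite inE ?xs ?ys orbT.
have s0 := ltnW (lmotzkin_size_gt1 wp); have r0 := ltnW (lmotzkin_size_gt1 wq).
rewrite map_cat map_rev; apply: lmotzkin_join.
- by apply: IHp => x y xs ys; apply: hf; rewrite mem_cat mem_rev ?xs ?ys.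
- by apply: IHq => x y xs ys; apply: hf; rewrite mem_cat ?xs ?ys orbT.
- rewrite !head_map_nat //; apply: hf => //; rewrite mem_cat ?mem_rev.
    by rewrite mem_head_nat.
  by rewrite (mem_head_nat r0) orbT.
Qed.

(** Links the partial sums of the definition to the inductive description; from here on only
    [lmotzkin] is used. *)
Lemma motzkin_wlP n p s : (1 < n)%N ->
  motzkin_wl n (p, s) <-> lmotzkin p s /\ perm_eq s (iota 1 n).
Proof.
move=> n1; rewrite lmotzkinP /motzkin_wl /well_labelled /=; split.
  move=> [[ep steps ps h] [hsum tot]]; split=> //.
  have es : size s = (size p).+1 by rewrite (perm_size ps) size_iota ep; lia.
  split.
    split=> // i hi; have [h1 h2] := h i (etrans (congr1 _ (esym ep)) hi).
    rewrite /step_ok (all_nthP 0 steps) //=; apply/andP.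
    by split; apply/implyP => /eqP.
  case/lastP: p => [|u x] in ep steps h hsum tot es *; first by move: ep => /=; lia.
  rewrite size_rcons in ep.
  have hu : forall j, (j <= size u)%N -> 0 <= 0 + \sum_(i <- take j u) i.
    move=> [|j] hj; rewrite ?take0 ?big_nil // add0r.
    by have := hsum j.+1; rewrite -cats1 takel_cat //; apply; lia.
  have := hu _ (leqnn _); rewrite take_size add0r.
  move: tot; rewrite -cats1 big_cat big_seq1 /= => tot hs.
  have xm : x \in [:: -1; 0; 1] by move: steps; rewrite all_rcons => /andP[].
  (* The last step is at least -1 and starts at a nonnegative height, so the total -1 leaves only
     this possibility. *)
  have [ex esum] : x = -1 /\ \sum_(i <- u) i = 0.
    by move: xm tot hs; rewrite !inE; move: (\sum_(i <- u) i) => S; lia.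
  exists u; first by rewrite ex cats1.
  by apply/excursionP; split; rewrite // add0r.
move=> [[wp [u ep hu]] ps].
have esp : size p = n.-1.
  by have [+ _] := wp; rewrite (perm_size ps) size_iota => ->.
have /excursionP[h1 h2] := hu.
split; first split=> //.
- exact: labelled_steps wp.
- move=> i; rewrite -esp => hi; case: wp => _ /(_ _ hi) /and3P[_ + +].
  by move=> /implyP a1 /implyP a2; split=> /eqP.
split.
  move=> j hj; have hju : (j <= size u)%N.
    by move: esp; rewrite ep size_rcons; lia.
  by rewrite ep -cats1 takel_cat // -[X in _ <= X]add0r; apply: h1.
by rewrite ep -cats1 big_cat big_seq1 /= -[X in X + _]add0r h2.
Qed.

(** * The inverse map *)

Definition join_paths (v w : wlpath) : wlpath :=
  if (head 0%N v.2 < head 0%N w.2)%N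
  then (flip v.1 ++ -1 :: w.1, rev v.2 ++ w.2)
  else (flip w.1 ++ -1 :: v.1, rev w.2 ++ v.2).

(** A single leaf gives the path without steps, which is not Motzkin; hence the separate clause for
    two leaves, where [minn] and [maxn] remove the dependence on their order. *)
Fixpoint Psi (t : btree) : wlpath :=
  match t with
  | Leaf a => ([::], [:: a])
  | Node (Leaf a) (Leaf b) => ([:: -1], [:: minn a b; maxn a b])
  | Node (Leaf a) u => (0 :: (Psi u).1, a :: (Psi u).2)
  | Node u (Leaf a) => (0 :: (Psi u).1, a :: (Psi u).2)
  | Node u v => join_paths (Psi u) (Psi v)
  end.

Definition is_leaf (t : btree) : bool := if t is Leaf _ then true else false.

Lemma Psi_leaf_node a u :
  ~~ is_leaf u -> Psi (Node (Leaf a) u) = (0 :: (Psi u).1, a :: (Psi u).2).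
Proof. by case: u. Qed.

Lemma Psi_node_leaf a u :
  ~~ is_leaf u -> Psi (Node u (Leaf a)) = (0 :: (Psi u).1, a :: (Psi u).2).
Proof. by case: u. Qed.

Lemma Psi_node u v : ~~ is_leaf u -> ~~ is_leaf v ->
  Psi (Node u v) = join_paths (Psi u) (Psi v).
Proof. by case: u => // ? ?; case: v. Qed.

(** The cases are the clauses of [Psi], which depend on which children are leaves. *)
Lemma btree_shape_ind (P : btree -> Prop) :
  (forall a, P (Leaf a)) ->
  (forall a b, P (Node (Leaf a) (Leaf b))) ->
  (forall a u, ~~ is_leaf u -> P u -> P (Node (Leaf a) u)) ->
  (forall a u, ~~ is_leaf u -> P u -> P (Node u (Leaf a))) ->
  (forall u v, ~~ is_leaf u -> ~~ is_leaf v -> P u -> P v -> P (Node u v)) ->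
  forall t, P t.
Proof.
move=> h1 h2 h3 h4 h5; elim=> [a|u Pu v Pv] //.
case lu: (is_leaf u); case lv: (is_leaf v).
- by case: u lu {Pu} => // a _; case: v lv {Pv} => // b _.
- by case: u lu {Pu} => // a _; apply: h3; rewrite ?lv.
- by case: v lv {Pv} => // a _; apply: h4; rewrite ?lu.
- by apply: h5; rewrite ?lu ?lv.
Qed.

Lemma size_leaves_gt0 t : (0 < size (leaves t))%N.
Proof. by elim: t => //= u Hu v _; rewrite size_cat; lia. Qed.

Lemma size_leaves_gt1 t : (1 < size (leaves t))%N = ~~ is_leaf t.
Proof.
case: t => //= u v; rewrite size_cat.
by have := size_leaves_gt0 u; have := size_leaves_gt0 v; lia.
Qed.

Lemma perm_Psi t : perm_eq (Psi t).2 (leaves t).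
Proof.
elim/btree_shape_ind: t => [a|a b|a u lu IH|a u lu IH|u v lu lv IHu IHv] //.
- rewrite /= /minn /maxn; case: ltnP => _ //.
  by rewrite (perm_catC [:: b] [:: a]).
- by rewrite Psi_leaf_node //= perm_cons.
- by rewrite Psi_node_leaf //= perm_sym (perm_catC _ [:: a]) perm_cons perm_sym.
- rewrite Psi_node // /join_paths /=.
  case: ifP => _ /=; first by rewrite perm_cat // perm_rev.
  by rewrite perm_catC perm_cat // perm_rev.
Qed.

Lemma size_Psi t : size (Psi t).2 = size (leaves t).
Proof. exact: perm_size (perm_Psi t). Qed.

Lemma head_Psi t : head 0%N (Psi t).2 \in leaves t.
Proof.
by rewrite -(perm_mem (perm_Psi t)) mem_head_nat // size_Psi size_leaves_gt0.
Qed.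

(** Each first label is a leaf of its own tree. Excluding ties makes [join_paths] symmetric and
    gives the strict inequality of [lmotzkin_join]. *)
Lemma head_Psi_neq u v : uniq (leaves u ++ leaves v) ->
  head 0%N (Psi u).2 != head 0%N (Psi v).2.
Proof.
rewrite cat_uniq => /and3P[_ /hasPn h _]; apply/eqP => e.
by have := h _ (head_Psi v); rewrite -e head_Psi.
Qed.

Lemma lmotzkin_Psi t :
  uniq (leaves t) -> ~~ is_leaf t -> lmotzkin (Psi t).1 (Psi t).2.
Proof.
elim/btree_shape_ind: t => [a|a b|a u lu IH|a u lu IH|u v lu lv IHu IHv] //.
- rewrite /= inE => /andP[ab _] _; apply: lmotzkin_pair; lia.
- by rewrite Psi_leaf_node //= => /andP[_ /IH h] _; apply/lmotzkin_flat/h.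
- rewrite Psi_node_leaf //= cat_uniq => /and3P[/IH h _ _] _.
  exact/lmotzkin_flat/h.
rewrite Psi_node //= => uuv _; have := head_Psi_neq uuv.
move: uuv; rewrite cat_uniq => /and3P[/IHu hu _ /IHv hv] neq.
rewrite /join_paths; case: ifP => hlt; apply: lmotzkin_join => //=; auto.
by rewrite ltnNge leq_eqVlt hlt orbF.
Qed.

(** * Compatibility of [Psi] with increasing relabellings *)

Lemma leaves_relabel f t : leaves (relabel f t) = map f (leaves t).
Proof. by elim: t => //= u -> v ->; rewrite map_cat. Qed.

Lemma is_leaf_relabel f t : is_leaf (relabel f t) = is_leaf t.
Proof. by case: t. Qed.

Lemma relabel_cancel f g t :
  {in leaves t, cancel g f} -> relabel f (relabel g t) = t.
Proof.
elim: t => /= [a h|u IHu v IHv h]; first by rewrite h // inE.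
by rewrite IHu ?IHv // => x hx; apply: h; rewrite mem_cat hx ?orbT.
Qed.

Lemma Psi_relabel f t : {in leaves t &, {homo f : x y / (x < y)%N}} ->
  Psi (relabel f t) = ((Psi t).1, map f (Psi t).2).
Proof.
elim/btree_shape_ind: t => [a|a b|a u lu IH|a u lu IH|u v lu lv IHu IHv] // hf.
- have := hf a b; have := hf b a; rewrite /= !inE !eqxx !orbT /minn /maxn.
  move=> /(_ isT isT) h1 /(_ isT isT) h2.
  case: (ltngtP a b) => [/h2|/h1|->]; last by rewrite ltnn.
    by move=> ->.
  by move=> h; rewrite ltnNge ltnW.
- rewrite [relabel _ _]/= !Psi_leaf_node ?is_leaf_relabel // IH // => x y hx hy.
  by apply: hf; rewrite inE ?hx ?hy orbT.
- rewrite [relabel _ _]/= !Psi_node_leaf ?is_leaf_relabel // IH // => x y hx hy.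
  by apply: hf; rewrite mem_cat ?hx ?hy.
rewrite [relabel _ _]/= !Psi_node ?is_leaf_relabel //.
rewrite IHu; last by move=> x y hx hy; apply: hf; rewrite mem_cat ?hx ?hy.
rewrite IHv; last by move=> x y hx hy; apply: hf; rewrite mem_cat ?hx ?hy orbT.
have hu := head_Psi u; have hv := head_Psi v.
have uI : head 0%N (Psi u).2 \in leaves (Node u v) by rewrite mem_cat hu.
have vI : head 0%N (Psi v).2 \in leaves (Node u v) by rewrite mem_cat hv orbT.
rewrite /join_paths !head_map_nat ?size_Psi ?size_leaves_gt0 //.
have h1 := hf _ _ uI vI; have h2 := hf _ _ vI uI.
(* By trichotomy [f] also reflects the comparison, so the same child is reversed before and after
   relabelling. *)
have -> : (f (head 0%N (Psi u).2) < f (head 0%N (Psi v).2))%N =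
          (head 0%N (Psi u).2 < head 0%N (Psi v).2)%N.
  case: ltngtP h1 h2 => [_ /(_ isT) //|_ _ /(_ isT) h|-> _ _]; last exact: ltnn.
  by rewrite ltnNge ltnW.
by case: ifP => _; rewrite /= map_cat map_rev.
Qed.

(** * Invariance of [Psi] under exchange of children *)

Lemma tree_iso_is_leaf t u : tree_iso t u -> is_leaf t = is_leaf u.
Proof. by case: t; case: u. Qed.

Lemma tree_iso_relabel f t u : tree_iso t u -> tree_iso (relabel f t) (relabel f u).
Proof.
elim: t u => [a|a IHa b IHb] [c|c d] //=; first by move/eqP->.
by case/orP=> /andP[/IHa-> /IHb->] //; rewrite orbT.
Qed.

Lemma join_pathsC v w :
  head 0%N v.2 != head 0%N w.2 -> join_paths v w = join_paths w v.
Proof. by rewrite /join_paths; case: ltngtP. Qed.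

Lemma Psi_swap u v : uniq (leaves u ++ leaves v) -> Psi (Node u v) = Psi (Node v u).
Proof.
move/head_Psi_neq; case: u v => [a|u1 u2] [b|v1 v2] //.
  by rewrite /= minnC maxnC.
by move=> neq; rewrite !(Psi_node (u := Node _ _)) // join_pathsC.
Qed.

Lemma Psi_tree_iso t u : uniq (leaves t) -> tree_iso t u -> Psi t = Psi u.
Proof.
(* [Psi] inspects whether children are leaves, so congruence relies on isomorphic trees agreeing in
   this. *)
have cong a b c d : tree_iso a c -> tree_iso b d -> Psi a = Psi c ->
    Psi b = Psi d -> Psi (Node a b) = Psi (Node c d).
  move=> /tree_iso_is_leaf + /tree_iso_is_leaf.
  case: a b c d => [a|a1 a2] [b|b1 b2] [c|c1 c2] [d|d1 d2] //= _ _.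
  - by move=> [->] [->].
  - by move=> [->] ->.
  - by move=> -> [->].
  - by move=> -> ->.
elim: t u => [a|a IHa b IHb] [c|c d] //; first by move=> _ /eqP->.
move=> uab; have := uab; rewrite [leaves _]/= cat_uniq => /and3P[ua _ ub].
case/orP=> /andP[ha hb]; first by apply: cong; auto.
by rewrite Psi_swap //; apply: cong; auto.
Qed.

(** * Phi and Psi are mutually inverse *)

(** The set $[n]\setminus\{a\}$ of clause (ii) is a permutation of [s], and [lam] and [laminv]
    depend on their list only up to permutation. *)
Lemma phi_fuel_flat f a p s : lmotzkin p s ->
  perm_eq (a :: s) (iota 1 (size s).+1) ->
  phi_fuel f.+1 (0 :: p) (a :: s) =
  Node (Leaf a) (relabel (lam s) (phi_fuel f p (map (laminv s) s))).
Proof.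
move=> w pas; have s1 := lmotzkin_size_gt1 w.
rewrite [LHS]/= ifF; last by lia.
have pI : perm_eq [seq i <- iota 1 (size s).+1 | i != a] s.
  apply: uniq_perm; first by rewrite filter_uniq ?iota_uniq.
    by have := iota_uniq 1 (size s).+1; rewrite -(perm_uniq pas) => /andP[].
  move=> x; rewrite mem_filter -(perm_mem pas) inE.
  have := iota_uniq 1 (size s).+1; rewrite -(perm_uniq pas) => /andP[+ _].
  by case: eqVneq => [->|] //= /negPf.
by rewrite -(lam_perm pI) -{1}(laminv_perm pI).
Qed.

(** Clause (iii) unfolded with [k] kept whole, so that its value can be substituted afterwards. *)
Lemma phi_fuel_up f p0 s : (2 < size s)%N ->
  let p : seq int := 1 :: p0 in
  let k := (find (fun y => y == 0) (psums 0 p)).+1 in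
  phi_fuel f.+1 p s =
  Node (relabel (lam (take k s))
         (phi_fuel f (flip (take k.-1 p)) (map (laminv (take k s)) (rev (take k s)))))
       (relabel (lam (drop k s))
         (phi_fuel f (drop k p) (map (laminv (drop k s)) (drop k s)))).
Proof. by move=> s2; rewrite /= leqNgt s2. Qed.

Lemma phi_fuel_join f p s q r : lmotzkin p s -> lmotzkin q r ->
  phi_fuel f.+1 (flip p ++ -1 :: q) (rev s ++ r) =
  Node (relabel (lam s) (phi_fuel f p (map (laminv s) s)))
       (relabel (lam r) (phi_fuel f q (map (laminv r) r))).
Proof.
move=> wp wq; have s1 := lmotzkin_size_gt1 wp; have r1 := lmotzkin_size_gt1 wq.
have es := lmotzkin_size wp; have [_ [u ep hu]] := lmotzkin_labelled wp.
have efp : flip p ++ -1 :: q = 1 :: (flip u ++ -1 :: q).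
  by rewrite ep flip_rcons opprK.
(* [k] counts the steps up to and including the joining one, and [flip p] has one step fewer than
   [s] has labels. *)
have ek : (find (fun y => y == 0) (psums 0 (1 :: (flip u ++ -1 :: q)))).+1 = size s.
  rewrite es ep size_rcons /= add0r -[X in psums X]add0r.
  by rewrite find_first_return ?size_flip //; apply: excursion_flip.
rewrite efp phi_fuel_up; last by rewrite size_cat size_rev; lia.
rewrite ek -efp -(size_rev s) take_size_cat // drop_size_cat // revK.
have ps : perm_eq (rev s) s by rewrite perm_rev.
rewrite (lam_perm ps) (laminv_perm ps) size_rev es /=.
rewrite take_size_cat ?size_flip // flipK.
by rewrite -cat_rcons drop_size_cat // size_rcons size_flip.
Qed.

Lemma Psi_phi_fuel f p s : (size s <= f)%N -> lmotzkin p s ->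
  perm_eq s (iota 1 (size s)) -> Psi (phi_fuel f p s) = (p, s).
Proof.
elim: f p s => [|f IH] p s hf w ps; first by have := lmotzkin_size_gt1 w; lia.
(* By [Psi_relabel], relabelling back undoes the standardization of the recursive call. The result
   has more than one label, so it is not a leaf and the clause of [Psi] at the root is known. *)
have std q r : (size r <= f)%N -> lmotzkin q r -> uniq r ->
    let t := relabel (lam r) (phi_fuel f q (map (laminv r) r)) in
    Psi t = (q, r) /\ ~~ is_leaf t.
  move=> hr wr ur; set t0 := phi_fuel _ _ _.
  have pr := perm_map_laminv ur.
  have e0 : Psi t0 = (q, map (laminv r) r).
    apply: IH; rewrite ?size_map //; apply: lmotzkin_map => //.
    exact: laminv_homo.
  have pl : perm_eq (leaves t0) (iota 1 (size r)).
    by apply: perm_trans pr; have := perm_Psi t0; rewrite e0 perm_sym.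
  have e : Psi (relabel (lam r) t0) = (q, r).
    rewrite Psi_relabel ?e0 /= ?map_lam_laminv // => x y.
    by rewrite !(perm_mem pl); apply: lam_homo.
  split=> //; rewrite -size_leaves_gt1 -size_Psi e.
  exact: lmotzkin_size_gt1 wr.
have us : uniq s by rewrite (perm_uniq ps) iota_uniq.
case: w hf ps us => {p s} [a b ab|a p s w|p s q r wp wq sr] hf ps us.
(* For two labels [phi_fuel] returns a fixed tree, so the labels have to be identified as 1 and 2 in
   this order. *)
- have : sorted leq [:: a; b] by rewrite /= ltnW.
  have -> // : [:: a; b] = [:: 1%N; 2%N].
  apply: (sorted_eq leq_trans anti_leq) => //; by rewrite /= ltnW.
- rewrite (phi_fuel_flat _ w) //.
  have [||e l] := std _ _ _ w; [exact: hf | by case/andP: us |].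
  by rewrite Psi_leaf_node // e.
- have s1 := lmotzkin_size_gt1 wp; have r1 := lmotzkin_size_gt1 wq.
  move: hf us; rewrite size_cat size_rev cat_uniq rev_uniq => hf /and3P[us _ ur].
  rewrite phi_fuel_join //.
  have [||e1 l1] := std _ _ _ wp; [lia | by [] |].
  have [||e2 l2] := std _ _ _ wq; [lia | by [] |].
  by rewrite Psi_node // e1 e2 /join_paths sr.
Qed.

(** Only an isomorphism is obtained, as [phi_fuel] puts a single leaf child on the left and the
    child that [Psi] reverses first. *)
Lemma phi_fuel_Psi f t : (size (leaves t) <= f)%N -> ~~ is_leaf t ->
  is_lbtree (size (leaves t)) t ->
  tree_iso (phi_fuel f (Psi t).1 (Psi t).2) t.
Proof.
elim: f t => [|f IH] t hf lt bt; first by have := size_leaves_gt0 t; lia.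
(* Standardizing the labels of [Psi u] amounts to applying [Psi] to the standardized tree, to which
   the induction hypothesis applies. *)
have std u (r := (Psi u).2) : (size (leaves u) <= f)%N -> ~~ is_leaf u ->
    uniq (leaves u) ->
    tree_iso (relabel (lam r) (phi_fuel f (Psi u).1 (map (laminv r) r))) u.
  move=> hu lu uu; have pu := perm_Psi u.
  have hm : {in leaves u &, {homo laminv r : x y / (x < y)%N}}.
    by move=> x y; rewrite -!(perm_mem pu); apply: laminv_homo.
  have := IH (relabel (laminv r) u); rewrite Psi_relabel //=.
  rewrite leaves_relabel size_map is_leaf_relabel => /(_ hu lu) h.
  rewrite -[X in tree_iso _ X](@relabel_cancel (lam r) (laminv r)); last first.
    by move=> x; rewrite -(perm_mem pu); apply: laminvK.
  apply: tree_iso_relabel; apply: h; rewrite /is_lbtree leaves_relabel.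
  by rewrite (laminv_perm pu) perm_map_laminv.
have ut : uniq (leaves t) by rewrite (perm_uniq bt) iota_uniq.
elim/btree_shape_ind: t => [a|a b|a u lu _|a u lu _|u v lu lv _ _] // in hf lt bt ut *.
- have /= := perm_mem bt; move: ut => /= /andP[]; rewrite !inE => ab _ h.
  have := h 1%N; have := h 2%N; rewrite !inE /= => h2 h1.
  by move: ab h1 h2; lia.
- have ps : perm_eq (a :: (Psi u).2) (iota 1 (size (Psi u).2).+1).
    by rewrite size_Psi; apply: perm_trans bt; rewrite perm_cons perm_Psi.
  have [_ uu] := andP ut.
  rewrite Psi_leaf_node // phi_fuel_flat //; last exact: lmotzkin_Psi.
  by rewrite /= eqxx std.
- have ps : perm_eq (a :: (Psi u).2) (iota 1 (size (Psi u).2).+1).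
    move: bt; rewrite /is_lbtree /= size_cat addn1 size_Psi; apply: perm_trans.
    by rewrite perm_sym (perm_catC _ [:: a]) perm_cons perm_sym perm_Psi.
  move: hf ut; rewrite [leaves _]/= size_cat addn1 cat_uniq => hf /and3P[uu _ _].
  rewrite Psi_node_leaf // phi_fuel_flat //; last exact: lmotzkin_Psi.
  by rewrite /= eqxx std // orbT.
- have := size_leaves_gt0 u; have := size_leaves_gt0 v.
  move: hf (ut); rewrite [leaves _]/= size_cat cat_uniq => hf /and3P[uu _ uv] v0 u0.
  have iu : _ := std u _ lu uu; have iv : _ := std v _ lv uv.
  have wu := lmotzkin_Psi uu lu; have wv := lmotzkin_Psi uv lv.
  rewrite Psi_node // /join_paths; case: ifP => _.
    by rewrite phi_fuel_join //= iu ?iv //; lia.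
  by rewrite phi_fuel_join //= iu ?iv ?orbT //; lia.
Qed.

Theorem theorem1 (n : nat) (hn : (1 < n)%N) :
  (forall w : wlpath, motzkin_wl n w -> is_lbtree n (Phi w)) /\
  (forall w1 w2 : wlpath, motzkin_wl n w1 -> motzkin_wl n w2 ->
      tree_iso (Phi w1) (Phi w2) -> w1 = w2) /\
  (forall t : btree, is_lbtree n t ->
      exists w : wlpath, motzkin_wl n w /\ tree_iso (Phi w) t).
Proof.
have PhiK w : motzkin_wl n w -> Psi (Phi w) = w.
  case: w => p s /(motzkin_wlP _ _ hn)[wp ps].
  by apply: Psi_phi_fuel => //; rewrite (perm_size ps) size_iota.
have Phi_lbtree w : motzkin_wl n w -> is_lbtree n (Phi w).
  (* The leaves of [Phi w] are the labels of [Psi (Phi w)], which is [w] itself. *)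
  move=> hw; have := perm_Psi (Phi w); rewrite (PhiK _ hw) perm_sym.
  by case: w hw => p s /(motzkin_wlP _ _ hn)[_ ps] /perm_trans; apply.
split=> //; split=> [w1 w2 h1 h2 iso|t bt].
  rewrite -(PhiK _ h1) -(PhiK _ h2); apply: Psi_tree_iso => //.
  by rewrite (perm_uniq (Phi_lbtree _ h1)) iota_uniq.
have es : size (leaves t) = n by rewrite (perm_size bt) size_iota.
have lt : ~~ is_leaf t by rewrite -size_leaves_gt1 es.
exists (Psi t); split; last by apply: phi_fuel_Psi; rewrite ?size_Psi ?es.
rewrite [Psi t]surjective_pairing; apply/motzkin_wlP => //; split.
  by apply: lmotzkin_Psi => //; rewrite (perm_uniq bt) iota_uniq.
exact: perm_trans (perm_Psi t) bt.
Qed.
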